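(* Let $s>0$. If $X$ is a compact metric space with $\overline{\dim}_B X<s$, then $\delta^s(X)<\infty$. Moreover, for any compact metric space $X$ we have $$\overline{\dim}_B X=\inf\{s>0:\delta^s(X)<\infty\}.$$
   Context: For a compact metric space $X$ and $r>0$ let $N(X,r)$ be the minimal number of closed balls of radius $r$ (centered in $X$) that cover $X$; the upper box dimension is $\overline{\dim}_B X=\limsup_{r\to0+}\frac{\log N(X,r)}{\log(1/r)}\in[0,\infty]$ for nonempty $X$ (and $0$ for the empty set). The infimum of the empty set is $+\infty$. Let $(X,d)$ be a metric space and $s>0$. For $n\ge1$ let $\mathrm{Sym}(n)$ be the set of bijections $\{1,\dots,n\}\to\{1,\dots,n\}$. For $x_1,\dots,x_n\in X$ define $$Z^s(x_1,\dots,x_n)=\max\left\{\sum_{j=1}^{k-1}(d(x_{i_j},x_{i_{j+1}}))^s: 1=i_1<\dots<i_k=n\right\},$$ $$\delta^s(X)=\sup\left\{\min_{\pi\in\mathrm{Sym}(n)}Z^s(x_{\pi(1)},\dots,x_{\pi(n)}): x_1,\dots,x_n\in X,\ n\ge1\right\}\in[0,\infty].$$ *)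

(* Defs.v *)
From HB Require Import structures.
From mathcomp Require Import all_boot all_order all_algebra all_fingroup.
From mathcomp Require Import all_classical all_reals all_analysis.

Set Implicit Arguments.
Unset Strict Implicit.
Unset Printing Implicit Defensive.

Import Order.TTheory GRing.Theory Num.Theory.
Import numFieldNormedType.Exports.

Local Open Scope classical_set_scope.
Local Open Scope ring_scope.

Section BoxDimension.
Context {R : realType}.
Implicit Types X : metricType R.

(* The library's [closed_ball] is the closure of the open ball, which may be
   strictly smaller in a general metric space. *)
Definition metric_closed_ball X (x : X) (r : R) : set X :=
  [set y | mdist x y <= r].

Definition covered_by X (r : R) (k : nat) : Prop :=
  exists c : 'I_k -> X, [set: X] `<=` \bigcup_i metric_closed_ball (c i) r.

(* The value is [+oo] when there is no finite cover; otherwise the infimum is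
   attained, being taken over a nonempty set of naturals. *)
Definition covering_number X (r : R) : \bar R :=
  ereal_inf [set (k%:R : R)%:E | k in covered_by X r].

Definition upper_box_dim X : \bar R :=
  if [set: X] == set0 then 0%E
  else limf_esup
    (fun r : R => (lne (covering_number X r) * ((ln (1 / r))^-1)%:E)%E) 0^'+.

End BoxDimension.

Section TravellingPath.
Context {R : realType} {X : metricType R}.

(* Points x_1, ..., x_n (n >= 1) are encoded as [x : 'I_m.+1 -> X], n = m + 1. *)

(* The sum of d(x_(i_j), x_(i_(j+1)))^s along the chain i_1 :: p. *)
Definition chain_sum (s : R) m (x : 'I_m.+1 -> X) (i1 : 'I_m.+1)
    (p : seq 'I_m.+1) : R :=
  \sum_(e <- zip (i1 :: p) p) (mdist (x e.1) (x e.2)) `^ s.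

(* A strictly increasing chain ord0 :: p in 'I_m.+1 has size p <= m, so [p] may
   be taken in a finite type; the sums are nonnegative, so the default value 0
   of the big maximum is harmless. *)
Definition Zs (s : R) m (x : 'I_m.+1 -> X) : R :=
  \big[Num.max/0]_(p : {bseq m of 'I_m.+1} |
      path (fun i j : 'I_m.+1 => (i < j)%N) ord0 p && (last ord0 p == ord_max))
    chain_sum s x ord0 p.

(* The default value of the big minimum is the term of the identity. *)
Definition min_Zs (s : R) m (x : 'I_m.+1 -> X) : R :=
  \big[Num.min/Zs s x]_(pi : 'S_m.+1) Zs s (x \o pi).

End TravellingPath.

(* The supremum is taken in [0, +oo]: it is 0 when [X] is empty, whereas
   [ereal_sup set0 = -oo]. *)
Definition delta {R : realType} (s : R) (X : metricType R) : \bar R :=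
  maxe 0%E
    (ereal_sup [set y | exists m (x : 'I_m.+1 -> X), y = (min_Zs s x)%:E]).

(* Main.v *)
(* If dim X < s, there are a bound B and, for every eps > 0, a function
   f : X -> [0, B] with d(x, y)^s <= |f x - f y| + eps.  Listing x_1, ..., x_n by
   increasing f makes every chain sum telescope to at most B + n * eps.  Such an f
   is built on nets of radius r0 / 2^k: each center of the finer net gets as parent
   a coarser center whose ball contains it, the finer net is ordered
   lexicographically by (f of the parent, index), and f is increased by the rank
   times (4 r)^s, r being the coarser radius.  The total increase is a geometric
   series since N(X, r) <= r^(-t) for some t < s.

   Conversely, if x_1, ..., x_n are r-separated, the chain through all points
   gives (n - 1) r^s <= delta^s(X) in any order, and a maximal r-separated family
   is an r-net, so N(X, r) = O(r^(-s)). *)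

Require Import Defs.
From mathcomp Require Import all_boot all_order all_algebra all_fingroup.
From mathcomp Require Import all_classical all_reals all_analysis.
From mathcomp Require Import lra.

Set Implicit Arguments.
Unset Strict Implicit.
Unset Printing Implicit Defensive.

Import Order.TTheory GRing.Theory Num.Theory.
Import numFieldNormedType.Exports.

Local Open Scope classical_set_scope.
Local Open Scope ring_scope.

(** * Chain sums: upper bound by sorting, lower bound by separation *)

Lemma sorting_perm (R : realType) m (h : 'I_m.+1 -> R) :
  exists pi : 'S_m.+1, forall i j : 'I_m.+1, (i < j)%N -> h (pi i) <= h (pi j).
Proof.
pose le := relpre h <=%R.
have le_trans' : transitive le by move=> y x z; apply: le_trans.
have le_total' : total le by move=> x y; apply: le_total.
have /tuple_permP[pi Epi] : perm_eq (sort le (enum 'I_m.+1)) (ord_tuple m.+1).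
  by rewrite /= perm_sort.
exists pi => i j ij.
have nth_sorted (k : 'I_m.+1) : nth ord0 (sort le (enum 'I_m.+1)) k = pi k.
  by rewrite Epi -tnth_nth tnth_mktuple tnth_ord_tuple.
have := sorted_ltn_nth le_trans' ord0 (sort_sorted le_total' (enum 'I_m.+1)) i j.
by rewrite !nth_sorted !inE size_sort size_enum_ord !ltn_ord; apply.
Qed.

Lemma chain_sum_cons (R : realType) (X : metricType R) (s : R) m
    (x : 'I_m.+1 -> X) i j p :
  chain_sum s x i (j :: p) = mdist (x i) (x j) `^ s + chain_sum s x j p.
Proof. by rewrite /chain_sum /= big_cons. Qed.

Lemma chain_sum_le_potential (R : realType) (X : metricType R) (s : R) m
    (x : 'I_m.+1 -> X) (F : 'I_m.+1 -> R) :
  (forall i j : 'I_m.+1, (i < j)%N ->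
     mdist (x i) (x j) `^ s <= F j - F i) ->
  forall i p, path (fun i j : 'I_m.+1 => (i < j)%N) i p ->
  chain_sum s x i p <= F (last i p) - F i.
Proof.
move=> dF i p; elim: p i => [i _|j p IH i /= /andP[ij jp]].
  by rewrite /chain_sum big_nil /= subrr.
rewrite chain_sum_cons; have := IH _ jp; have := dF _ _ ij; lra.
Qed.

Lemma min_Zs_le (R : realType) (X : metricType R) (s B e : R) m
    (x : 'I_m.+1 -> X) (f : X -> R) :
  0 <= e -> (forall y, 0 <= f y <= B) ->
  (forall y z, mdist y z `^ s <= `|f y - f z| + e) ->
  min_Zs s x <= B + m%:R * e.
Proof.
move=> e0 fB df; have [pi sorted_pi] := sorting_perm (f \o x).
apply: le_trans (bigmin_le _ pi _) _.
have B0 : 0 <= B by have /andP[/le_trans] := fB (x ord0); apply.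
apply: bigmax_le => [|p /andP[chain_p /eqP last_p]].
  by rewrite addr_ge0 // mulr_ge0.
(* For [i < j], [e <= (j - i) * e], so the term [i * e] absorbs one error per step of the chain and
   the sum still telescopes. *)
pose F (i : 'I_m.+1) := f (x (pi i)) + i%:R * e.
have dF (i j : 'I_m.+1) : (i < j)%N ->
    mdist ((x \o pi) i) ((x \o pi) j) `^ s <= F j - F i.
  move=> ij; rewrite /F /=; have := df (x (pi i)) (x (pi j)).
  rewrite distrC ger0_norm ?subr_ge0; last exact: sorted_pi ij.
  have : e <= (j%:R - i%:R) * e.
    by rewrite ler_peMl // -natrB 1?ltnW // ler1n subn_gt0.
  rewrite mulrBl; lra.
apply: le_trans (chain_sum_le_potential dF chain_p) _.
rewrite last_p /F /= mul0r.
have /andP[_ le_B] := fB (x (pi ord_max)).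
have /andP[ge_0 _] := fB (x (pi ord0)).
lra.
Qed.

Lemma chain_sum_ge_separated (R : realType) (X : metricType R) (s r : R) m
    (x : 'I_m.+1 -> X) :
  0 <= s -> 0 <= r -> (forall i j, i != j -> r <= mdist (x i) (x j)) ->
  forall i p, path (fun i j : 'I_m.+1 => (i < j)%N) i p ->
  (size p)%:R * r `^ s <= chain_sum s x i p.
Proof.
move=> s0 r0 sep i p; elim: p i => [i _|j p IH i /= /andP[ij jp]].
  by rewrite /chain_sum big_nil mul0r.
rewrite chain_sum_cons -nat1r mulrDl mul1r lerD ?IH //.
apply: ge0_ler_powR => //; rewrite ?nnegrE ?mdist_ge0 //.
by apply: sep; rewrite -val_eqE /= ltn_eqF.
Qed.

(** The chain through every index has [m] steps, each worth at least [r ^ s], and reordering the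
    points keeps them separated. *)
Lemma min_Zs_ge (R : realType) (X : metricType R) (s r : R) m
    (x : 'I_m.+1 -> X) :
  0 <= s -> 0 <= r -> (forall i j, i != j -> r <= mdist (x i) (x j)) ->
  m%:R * r `^ s <= min_Zs s x.
Proof.
move=> s0 r0 sep.
have Zs_ge (y : 'I_m.+1 -> X) :
    (forall i j, i != j -> r <= mdist (y i) (y j)) ->
    m%:R * r `^ s <= Zs s y.
  move=> sepy.
  have enumE : ord0 :: behead (enum 'I_m.+1) = enum 'I_m.+1.
    by rewrite enum_ordSl.
  have sz : size (behead (enum 'I_m.+1)) = m by rewrite size_behead size_enum_ord.
  have chain : path (fun i j : 'I_m.+1 => (i < j)%N) ord0
      (behead (enum 'I_m.+1)).
    have := iota_ltn_sorted 0 m.+1.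
    by rewrite -val_enum_ord sorted_map -enumE.
  have sz' : (size (behead (enum 'I_m.+1)) <= m)%N by rewrite sz.
  apply: (@bigmax_sup _ _ _ _ (Bseq sz')) => /=.
    rewrite chain -[last _ _]/(last ord0 (ord0 :: _)) enumE enum_ordSr.
    by rewrite last_rcons eqxx.
  by rewrite -{1}sz; apply: chain_sum_ge_separated.
apply: le_bigmin => [|pi _]; apply: Zs_ge => // i j ij.
by apply: sep; rewrite (inj_eq perm_inj).
Qed.

(** * Potentials on successively finer nets *)

Lemma ltn_rank (disp : Order.disp_t) (T : porderType disp) (I : finType)
    (g : I -> T) (i j : I) :
  (g i < g j)%O -> (#|[pred k | (g k < g i)%O]| < #|[pred k | (g k < g j)%O]|)%N.
Proof.
move=> gij; apply/proper_card/properP; split.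
  by apply/fintype.subsetP => k; rewrite !inE => /lt_trans; apply.
by exists i; rewrite inE ?ltxx.
Qed.

Lemma powR_le (R : realType) (s a b : R) :
  0 <= s -> 0 <= a -> a <= b -> a `^ s <= b `^ s.
Proof. by move=> s0 a0 ab; apply: ge0_ler_powR; rewrite ?nnegrE // (le_trans a0). Qed.

(* Passing to descendants through all finer levels moves each of the two centers
   by at most r + r / 2 + r / 4 + ... = 2 r; the margin [4 * r] absorbs this. *)
Definition potential (R : realType) (X : metricType R) (s r : R) n
    (c : 'I_n -> X) (f : 'I_n -> R) : Prop :=
  forall i j, i != j -> (mdist (c i) (c j) + 4 * r) `^ s <= `|f i - f j|.

Lemma potential_refine (R : realType) (X : metricType R) (s r B : R) n n'
    (c : 'I_n -> X) (c' : 'I_n' -> X) (f : 'I_n -> R) :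
  0 <= s -> 0 <= r -> [set: X] `<=` \bigcup_i metric_closed_ball (c i) r ->
  potential s r c f -> (forall i, 0 <= f i <= B) ->
  exists f' : 'I_n' -> R, potential s (r / 2) c' f' /\
    forall i, 0 <= f' i <= B + n'%:R * (4 * r) `^ s.
Proof.
move=> s0 r0 cover pot fB.
have /choice[par parP] : forall p, exists i, mdist (c i) (c' p) <= r.
  by move=> p; have [i _ ip] := cover (c' p) I; exists i.
(* Lexicographic order: children of distinct centers keep the order of their
   parents, and siblings are separated by the rank. *)
pose g p : (R *l 'I_n')%type := (f (par p), p).
pose rk p := #|[pred q | (g q < g p)%O]|.
have w0 : 0 <= (4 * r) `^ s by apply: powR_ge0.
exists (fun p => f (par p) + (rk p)%:R * (4 * r) `^ s); split; last first.
  move=> p; have /andP[f0 fle] := fB (par p).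
  rewrite addr_ge0 ?mulr_ge0 ?lerD ?ler_wpM2r // ler_nat.
  by rewrite (leq_trans (max_card _)) ?card_ord.
move=> p q pq; wlog gpq : p q pq / (g p < g q)%O.
  move=> H; have [/(H _ _ pq)//|gqp|gE] := ltgtP (g p) (g q).
    by rewrite distrC metric_sym; apply: H gqp; rewrite eq_sym.
  by case: gE pq => _ ->; rewrite eqxx.
have rkpq : (rk p < rk q)%N by apply: ltn_rank.
have fpq : f (par p) <= f (par q).
  by move: gpq; rewrite ltEprodlexi => /andP[].
have dpar := parP p; have dpar' := parP q; rewrite metric_sym in dpar.
have tri1 := metric_triangle (c' p) (c (par p)) (c' q).
have tri2 := metric_triangle (c (par p)) (c (par q)) (c' q).
have d0 := mdist_ge0 (c' p) (c' q).
rewrite distrC [leRHS]ger0_norm; last first.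
  by rewrite subr_ge0 lerD // ler_wpM2r // ler_nat ltnW.
have rkw : (4 * r) `^ s <= ((rk q)%:R - (rk p)%:R) * (4 * r) `^ s.
  by rewrite ler_peMl // -natrB 1?ltnW // ler1n subn_gt0.
rewrite mulrBl in rkw.
have [parE|parN] := eqVneq (par p) (par q).
  have -> : f (par p) = f (par q) by rewrite parE.
  rewrite parE ?mdistxx in tri1 tri2 dpar.
  (* Siblings are at distance at most [2 * r]; with the new margin [4 * (r / 2)] this is at most
     [4 * r], which one rank step pays for. *)
  suff : (mdist (c' p) (c' q) + 4 * (r / 2)) `^ s <= (4 * r) `^ s by lra.
  by rewrite powR_le // ?addr_ge0 //; lra.
have := pot _ _ parN; rewrite distrC ger0_norm ?subr_ge0 //.
(* Passing to the parents costs [2 * r], exactly what the margin loses when it shrinks from [4 * r]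
   to [2 * r]. *)
suff : (mdist (c' p) (c' q) + 4 * (r / 2)) `^ s <=
   (mdist (c (par p)) (c (par q)) + 4 * r) `^ s by lra.
by rewrite powR_le // ?addr_ge0 //; lra.
Qed.

Lemma potential_exists (R : realType) (X : metricType R) (s r : R) n
    (c : 'I_n -> X) :
  exists B (f : 'I_n -> R),
    [/\ 0 <= B, potential s r c f & forall i, 0 <= f i <= B].
Proof.
(* [D] dominates every required gap, so values spaced by [D] suffice. *)
pose D := \sum_i \sum_j (mdist (c i) (c j) + 4 * r) `^ s.
have D0 : 0 <= D.
  by apply: sumr_ge0 => i _; apply: sumr_ge0 => j _; apply: powR_ge0.
exists (n%:R * D), (fun i => i%:R * D); split; first by rewrite mulr_ge0.
- move=> i j ij; apply: (@le_trans _ _ D).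
    rewrite /D (bigD1 i) //= (bigD1 j) //= -addrA lerDl addr_ge0 //.
      by apply: sumr_ge0 => k _; apply: powR_ge0.
    by apply: sumr_ge0 => k _; apply: sumr_ge0 => l _; apply: powR_ge0.
  rewrite -mulrBl normrM (ger0_norm D0) ler_peMl //.
  have : (i : nat) != j by rewrite val_eqE.
  by case: (ltngtP i j) => // ij' _; [rewrite distrC|];
    rewrite -natrB 1?ltnW // normr_nat ler1n subn_gt0.
- by move=> i; rewrite mulr_ge0 //= ler_wpM2r // ler_nat ltnW.
Qed.

(** The refinement to level [k + 1] raises the bound by [n * (4 * r_k) ^ s], where
    [4 * r_k = 8 * r_(k+1)]; the geometric hypothesis makes these increments summable, so [B] does
    not depend on the level. *)
Lemma nearly_potential (R : realType) (X : metricType R) (s r M q : R) :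
  0 < s -> 0 <= r -> 0 <= M -> 0 <= q < 1 ->
  (forall k, exists n, Defs.covered_by X (r / 2 ^+ k) n /\
     n%:R * (8 * (r / 2 ^+ k)) `^ s <= M * q ^+ k) ->
  exists B, forall k, exists f : X -> R, (forall x, 0 <= f x <= B) /\
    forall x y, mdist x y `^ s <= `|f x - f y| + (2 * (r / 2 ^+ k)) `^ s.
Proof.
move=> s0 r0 M0 /andP[q0 q1] covers.
pose A := M / (1 - q).
have A0 : 0 <= A by rewrite divr_ge0 // subr_ge0 ltW.
have [n [[c0 _] _]] := covers 0%N.
have rk0 k : 0 <= r / 2 ^+ k by rewrite divr_ge0 // exprn_ge0.
(* [A * (1 - q ^ k)] is the partial sum [M + M * q + ... + M * q ^ (k - 1)]. *)
suff [B HB] : exists B, forall k, exists n (c : 'I_n -> X) (f : 'I_n -> R),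
    [/\ [set: X] `<=` \bigcup_i metric_closed_ball (c i) (r / 2 ^+ k),
        potential s (r / 2 ^+ k) c f &
        forall i, 0 <= f i <= B + A * (1 - q ^+ k)].
  exists (B + A) => k; have [n' [c [f [cover pot fB]]]] := HB k.
  have /choice[near nearP] : forall x, exists i, mdist (c i) x <= r / 2 ^+ k.
    by move=> x; have [i _ ix] := cover x I; exists i.
  exists (f \o near); split=> [x|x y] /=.
    have /andP[-> /le_trans] /= := fB (near x); apply.
    by rewrite lerD2l ler_piMr // gerBl exprn_ge0.
  have xn := nearP x; rewrite metric_sym in xn; have yn := nearP y.
  have := metric_triangle x (c (near x)) y.
  have := metric_triangle (c (near x)) (c (near y)) y.
  (* Points sharing a center are within twice the radius, which the error term covers; otherwise the
     margin of the potential absorbs the move to the centers. *)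
  have [nE|nN] := eqVneq (near x) (near y).
    rewrite nE in xn *; rewrite mdistxx => t1 t2; rewrite subrr normr0 add0r.
    by rewrite powR_le ?mdist_ge0 ?(ltW s0) //; lra.
  move=> t1 t2; apply: ler_wpDr; first exact: powR_ge0.
  apply: le_trans (pot _ _ nN); rewrite powR_le ?mdist_ge0 ?(ltW s0) //.
  by have := rk0 k; lra.
have [n0 [[c cover0] _]] := covers 0%N.
have [B [f [B0 pot fB]]] := potential_exists s (r / 2 ^+ 0) c.
exists B; elim=> [|k [n1 [c1 [f1 [cover1 pot1 f1B]]]]].
  by exists n0, c, f; rewrite subrr mulr0 addr0.
have [n2 [[c2 cover2] n2M]] := covers k.+1.
have [f2 [pot2 f2B]] := potential_refine c2 (ltW s0) (rk0 k) cover1 pot1 f1B.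
have half : r / 2 ^+ k.+1 = r / 2 ^+ k / 2 by rewrite exprSr invfM mulrA.
exists n2, c2, f2; split=> [//||i]; first by rewrite half.
have /andP[-> /le_trans] /= := f2B i; apply.
rewrite -addrA lerD2l.
have -> : 4 * (r / 2 ^+ k) = 8 * (r / 2 ^+ k.+1) by rewrite half; lra.
apply: le_trans (lerD (lexx _) n2M) _.
have AE : A * (1 - q) = M by rewrite divfK // subr_eq0 gt_eqF.
have : M * q ^+ k.+1 <= A * (1 - q) * q ^+ k.
  by rewrite AE exprS ler_wpM2l // ler_piMl ?exprn_ge0 // ltW.
rewrite exprS; lra.
Qed.

(** * From box dimension to covers at small scales *)

Lemma at_right0P (R : realType) (V : set R) :
  at_right 0 V <-> exists2 e, 0 < e & forall r, 0 < r < e -> V r.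
Proof.
split=> [/nbhs_ballP[e /= e0 eV]|[e e0 eV]].
  exists e => // r /andP[r0 re]; apply: eV => //=.
  by rewrite /ball /= sub0r normrN gtr0_norm.
apply/nbhs_ballP; exists e => //= r; rewrite /ball /= sub0r normrN => re r0.
by apply: eV; rewrite r0 -(gtr0_norm r0).
Qed.

Lemma ln_inv_gt0 (R : realType) (r : R) : 0 < r -> r < 1 -> 0 < ln (1 / r).
Proof. by move=> r0 r1; rewrite ln_gt0 // div1r invf_gt1. Qed.

Lemma lne_ltP (R : realType) (N : \bar R) (a : R) :
  (lne N < a%:E)%E = (N < (expR a)%:E)%E.
Proof.
case: N => [x||] //=; last by rewrite !ltNyr.
case: ifPn => [x0|]; first by rewrite ltNyr lte_fin (le_lt_trans x0) ?expR_gt0.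
by rewrite -ltNge => x0; rewrite !lte_fin -[in RHS](lnK x0) ltr_expR.
Qed.

Lemma powR_ln_inv (R : realType) (r a : R) :
  0 < r -> expR (a * ln (1 / r)) = r `^ (- a).
Proof. by move=> r0; rewrite /powR gt_eqF // div1r lnV // mulrN mulNr. Qed.

Lemma upper_box_dim_lt (R : realType) (X : metricType R) (s : R) :
  [set: X] != set0 -> (upper_box_dim X < s%:E)%E ->
  exists t r0 : R, [/\ t < s, 0 < r0 & forall r, 0 < r <= r0 ->
    exists n, Defs.covered_by X r n /\ n%:R <= r `^ (- t)].
Proof.
move=> /negPf X0; rewrite /upper_box_dim X0.
case/ereal_inf_lt=> _ [V /at_right0P[e e0 eV] <-] supV.
have [t ts Vt] : exists2 t, t < s &
    (ereal_sup [set (lne (Defs.covering_number X r) * ((ln (1 / r))^-1)%:E)%E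
       | r in V] < t%:E)%E.
  (* A finite supremum [u] leaves room for the midpoint of [u] and [s]; below [-oo] any [t < s]
     would do. *)
  case: ereal_sup supV => [u||] //= us; last by exists (s - 1); rewrite ?ltNyr; lra.
  by rewrite lte_fin in us; exists ((u + s) / 2); rewrite ?lte_fin; lra.
exists t, (Num.min e 1 / 2).
have m0 : 0 < Num.min e 1 by rewrite lt_min e0 ltr01.
split=> // [|r /andP[r0 re]]; first by rewrite divr_gt0.
have {}re : r < Num.min e 1 by apply: le_lt_trans re _; lra.
rewrite lt_min in re; case/andP: re => re r1.
have L0 := ln_inv_gt0 r0 r1.
have : (lne (Defs.covering_number X r) * ((ln (1 / r))^-1)%:E < t%:E)%E.
  apply: le_lt_trans Vt; apply: ereal_sup_ubound; exists r => //.
  by apply: eV; rewrite r0.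
rewrite lte_pdivrMr // -EFinM lne_ltP powR_ln_inv //.
case/ereal_inf_lt => _ [n cov <-]; rewrite lte_fin => /ltW nr.
by exists n.
Qed.

(** * Dimension below [s] makes [delta s X] finite *)

Lemma delta_lty (R : realType) (X : metricType R) (s B : R) :
  (forall m (x : 'I_m.+1 -> X), min_Zs s x <= B) -> (delta s X < +oo)%E.
Proof.
move=> HB; rewrite /delta gt_max ltry /=.
apply: (@le_lt_trans _ _ B%:E); last by rewrite ltry.
by apply: ge_ereal_sup => _ [m [x ->]]; rewrite lee_fin.
Qed.

Lemma delta_finite (R : realType) (X : metricType R) (s : R) :
  0 < s -> (upper_box_dim X < s%:E)%E -> (delta s X < +oo)%E.
Proof.
move=> s0 dim_s; have [XE|X0] := eqVneq [set: X] set0.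
  apply: (@delta_lty _ _ _ 0) => m x.
  by have : [set: X] (x ord0) by []; rewrite XE.
have [t [r0 [ts r00 cov]]] := upper_box_dim_lt X0 dim_s.
pose u := s - t; have u0 : 0 < u by rewrite subr_gt0.
(* With [n <= r_k ^ (- t)], the cost [n * (8 * r_k) ^ s] is at most [8 ^ s * r_k ^ u], which is
   geometric of ratio [2 ^ (- u)]. *)
pose q : R := 2^-1 `^ u; pose M := 8 `^ s * r0 `^ u.
have q0 : 0 < q by rewrite powR_gt0.
have q1 : q < 1.
  have -> : 1 = 1 `^ u :> R by rewrite powR1.
  by rewrite gt0_ltr_powR ?nnegrE // invf_lt1 // ltr1n.
have M0 : 0 <= M by rewrite mulr_ge0 ?powR_ge0.
have rk0 k : 0 < r0 / 2 ^+ k by rewrite divr_gt0 // exprn_gt0.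
have covers k : exists n, Defs.covered_by X (r0 / 2 ^+ k) n /\
    n%:R * (8 * (r0 / 2 ^+ k)) `^ s <= M * q ^+ k.
  have [|n [covn nle]] := cov (r0 / 2 ^+ k).
    rewrite rk0 ler_pdivrMr ?exprn_gt0 // ler_peMr ?(ltW r00) //.
    by rewrite exprn_ege1 // ler1n.
  exists n; split=> //.
  rewrite powRM ?(ltW (rk0 k)) //.
  have -> : M * q ^+ k = 8 `^ s * (r0 / 2 ^+ k) `^ u.
    rewrite /M -mulrA -exprVn powRM ?(ltW r00) ?exprn_ge0 ?invr_ge0 //.
    by rewrite -[in RHS]powR_mulrn ?invr_ge0 // powRAC powR_mulrn ?powR_ge0.
  rewrite mulrCA ler_wpM2l ?powR_ge0 //.
  have -> : (r0 / 2 ^+ k) `^ u = (r0 / 2 ^+ k) `^ (- t) * (r0 / 2 ^+ k) `^ s.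
    by rewrite -powRD ?(gt_eqF (rk0 k)) ?implybT // addrC.
  by rewrite ler_wpM2r ?powR_ge0.
have [|B HB] := nearly_potential s0 (ltW r00) M0 _ covers; first by rewrite ltW.
apply: (@delta_lty _ _ _ (B + 1)) => m x.
(* The space contains a point here, so a cover has [n >= 1] balls. *)
have error_le k : (2 * (r0 / 2 ^+ k)) `^ s <= M * q ^+ k.
  have [n [[c covn] nle]] := covers k.
  have [i _ _] := covn (x ord0) I.
  apply: le_trans nle; apply: (@le_trans _ _ ((8 * (r0 / 2 ^+ k)) `^ s)).
    by have rk := rk0 k; rewrite powR_le // ?(ltW s0) //; lra.
  by rewrite ler_peMl ?powR_ge0 // ler1n (leq_ltn_trans _ (ltn_ord i)).
(* The level [k] may depend on the number of points because [B] was fixed before it; the total error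
   is then at most 1. *)
have [k qk] : exists k, m%:R * (M * q ^+ k) <= 1.
  have q_lt1 : `|q| < 1 by rewrite gtr0_norm.
  have mM : 0 < m%:R * M + 1 by rewrite ltr_wpDl // mulr_ge0.
  have : nbhs (0 : R) (ball 0 (m%:R * M + 1)^-1).
    by apply: nbhsx_ballx; rewrite invr_gt0.
  case/(cvg_expr q_lt1) => k _ /(_ k (leqnn _)).
  rewrite /= /ball /= sub0r normrN ger0_norm ?exprn_ge0 ?(ltW q0) // => qk.
  exists k; rewrite mulrA; apply: (@le_trans _ _ ((m%:R * M + 1) * q ^+ k)).
    by rewrite ler_wpM2r ?exprn_ge0 ?(ltW q0) // lerDl.
  by rewrite -ler_pdivlMl // mulr1 ltW.
have [f [fB df]] := HB k.
apply: le_trans (min_Zs_le x (powR_ge0 _ _) fB df) _.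
by rewrite lerD2l (le_trans _ qk) // ler_wpM2l.
Qed.

(** * Separated families and the converse bound *)

(** A separated family of maximal size is a net: a point outside all its balls could be appended to
    it. *)
Lemma covered_by_separated (R : realType) (X : metricType R) (r : R) (K : nat) :
  (forall m (x : 'I_m.+1 -> X),
     (forall i j, i != j -> r <= mdist (x i) (x j)) -> (m <= K)%N) ->
  exists2 n, Defs.covered_by X r n & (n <= K.+1)%N.
Proof.
move=> HK.
pose sep n := exists x : 'I_n -> X, forall i j, i != j -> r <= mdist (x i) (x j).
have sep0 : exists n, `[< sep n >].
  have x : 'I_0 -> X by case.
  by exists 0%N; apply/asboolP; exists x => -[].
have sepK n : `[< sep n >] -> (n <= K.+1)%N.
  by case: n => [|n] // /asboolP[x /HK].
case: (ex_maxnP sep0 sepK) => n /asboolP[x sepx] max_n.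
exists n; last exact/sepK/asboolP/(ex_intro _ x).
exists x => y _; apply: contrapT => far.
have far_y i : r <= mdist (x i) y.
  by rewrite leNgt; apply/negP => /ltW yi; apply: far; exists i.
suff /asboolP/max_n : sep n.+1 by rewrite ltnn.
exists (fun i => oapp x y (unlift ord_max i)) => i j.
case: (unliftP ord_max i) => [i'|] ->; case: (unliftP ord_max j) => [j'|] -> /=;
  rewrite ?liftK ?unlift_none /= ?eqxx // ?(inj_eq lift_inj).
- exact: sepx.
- by rewrite metric_sym.
Qed.

(** A nonempty space needs at least one ball, so the logarithms are nonnegative for [r < 1]. *)
Lemma upper_box_dim_ge0 (R : realType) (X : metricType R) :
  (0 <= upper_box_dim X)%E.
Proof.
rewrite /upper_box_dim; case: ifPn => // /set0P[x0 _].
apply: le_ereal_inf_tmp => _ [V /at_right0P[e e0 eV] <-].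
have m0 : 0 < Num.min e 1 by rewrite lt_min e0 ltr01.
pose r := Num.min e 1 / 2.
have r0 : 0 < r by rewrite divr_gt0.
have : r < Num.min e 1 by rewrite /r; lra.
rewrite lt_min => /andP[re r1].
apply: le_ereal_sup_tmp; eexists; first by exists r => //; apply: eV; rewrite r0.
rewrite mule_ge0 ?lee_fin ?invr_ge0 ?(ltW (ln_inv_gt0 r0 r1)) // lne_ge0.
apply: le_ereal_inf_tmp => _ [n [c cov] <-].
have [i _ _] := cov x0 I.
by rewrite lee_fin ler1n (leq_ltn_trans _ (ltn_ord i)).
Qed.

Lemma upper_box_dim_le (R : realType) (X : metricType R) (s : R) :
  0 < s -> (delta s X < +oo)%E -> (upper_box_dim X <= s%:E)%E.
Proof.
move=> s0 delta_fin.
rewrite /upper_box_dim; case: ifPn => [_|_]; first by rewrite lee_fin ltW.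
have [C C0 HC] : exists2 C, 0 <= C &
    forall m (x : 'I_m.+1 -> X), min_Zs s x <= C.
  have delta0 : (0 <= delta s X)%E by rewrite /delta le_max lexx.
  exists (fine (delta s X)); first exact: fine_ge0.
  move=> m x; rewrite -lee_fin fineK ?ge0_fin_numE // /delta le_max.
  by apply/orP; right; apply: ereal_sup_ubound; exists m, x.
apply/lee_addgt0Pr => e e0.
(* Chosen so that [r < e1] gives [2 + C <= r ^ (- e)]; then [1 + C * r ^ (- s) < (2 + C) * r ^ (- s)
   <= r ^ (- (s + e))]. *)
pose e1 := expR (- (ln (2 + C) / e)).
have C2 : 1 < 2 + C by lra.
have lnC : 0 < ln (2 + C) by rewrite ln_gt0.
apply: ge_ereal_inf; eexists.
  exists [set r | 0 < r < e1] => //.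
  by apply/at_right0P; exists e1; rewrite ?expR_gt0.
apply: ge_ereal_sup => _ [r /andP[r0 re] <-].
have r1 : r < 1.
  apply: lt_trans re _; rewrite expR_lt1 oppr_lt0 divr_gt0 //.
have L0 := ln_inv_gt0 r0 r1.
rewrite lee_pdivrMr // -EFinD -EFinM ltW // lne_ltP powR_ln_inv //.
have rs : 0 < r `^ s by rewrite powR_gt0.
have rs1 : 1 <= (r `^ s)^-1.
  rewrite invf_ge1 //; have -> : 1 = 1 `^ s :> R by rewrite powR1.
  by rewrite powR_le // ltW.
have Crs : 0 <= C / r `^ s by rewrite divr_ge0 // ltW.
(* [m + 1] points that are [r]-separated force [m * r ^ s <= C]. *)
have [|n cov nle] := @covered_by_separated _ X r (Num.truncn (C / r `^ s)).
  move=> m x sepx; rewrite truncn_ge_nat //.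
  rewrite ler_pdivlMr //; apply: le_trans (HC _ x).
  by apply: min_Zs_ge; rewrite ?ltW.
apply: (@le_lt_trans _ _ n%:R%:E); first by apply: ereal_inf_lbound; exists n.
rewrite lte_fin.
have nC : n%:R <= 1 + C / r `^ s.
  apply: (@le_trans _ _ (Num.truncn (C / r `^ s)).+1%:R); first by rewrite ler_nat.
  by rewrite -nat1r lerD2l truncn_le.
apply: (@lt_le_trans _ _ ((2 + C) * (r `^ s)^-1)); first by rewrite mulrDl; lra.
have -> : - (s + e) = - e - s by lra.
rewrite powRB ?(gt_eqF r0) ?implybT // ler_wpM2r ?invr_ge0 ?(ltW rs) //.
rewrite -powR_ln_inv // -ler_ln ?posrE ?expR_gt0 //; last by lra.
rewrite expRK div1r lnV // -ler_pdivrMl // mulrC lerNr.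
by rewrite -ler_expR lnK // ltW.
Qed.

Theorem theorem1p14 (R : realType) :
  (forall (s : R) (X : metricType R),
     0 < s -> compact [set: X] ->
     (upper_box_dim X < s%:E)%E -> (delta s X < +oo)%E) /\
  (forall X : metricType R,
     compact [set: X] ->
     upper_box_dim X =
       ereal_inf [set s%:E | s in [set s : R | 0 < s /\ (delta s X < +oo)%E]]).
Proof.
split=> [s X s0 _|X _]; first exact: delta_finite.
apply/eqP; rewrite eq_le; apply/andP; split.
  by apply: le_ereal_inf_tmp => _ [s [s0 sfin] <-]; apply: upper_box_dim_le.
(* For finite dimension [d], each [d + e] is an admissible exponent by the first part. *)
apply/lee_addgt0Pr => e e0.
case dimE : (upper_box_dim X) => [d||]; first 1 last.
- by rewrite leey.
- by have := upper_box_dim_ge0 X; rewrite dimE.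
have d0 : 0 <= d by rewrite -lee_fin -dimE upper_box_dim_ge0.
apply: ereal_inf_lbound; exists (d + e) => //; split; first by rewrite ltr_wpDl.
by apply: delta_finite; rewrite ?ltr_wpDl // dimE lte_fin ltrDl.
Qed.
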